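(* Let the basic ${}^{L}/_{L^{g}}$ function algebra $C(X,\tau,g)$ on $(X,\tau,g)$ be such that $\mathrm{Gal}(L/L^{g})$ and $\langle\mathrm{id}\rangle$ are respectively at the top and bottom of a lattice of groups with intermediate elements. Then $C_{L}(X)$ and $C(X,\tau,g)$ are respectively at the top and bottom of a particular lattice of basic function algebras with intermediate elements, and there is a one-one correspondence between the subgroups of $\mathrm{Gal}(L/L^{g})$ and the elements of this lattice, which is called the lattice of basic extensions of $C(X,\tau,g)$.
   Context: A valuation on a field $F$ is a multiplicative norm $|\cdot|_{F}:F\to\mathbb{R}$; $F$ with a valuation is a valued field, complete if complete in the induced metric, non-Archimedean if $|a-b|_F\le\max(|a|_F,|b|_F)$ for all $a,b\in F$, else Archimedean. $L$ extends $F$ as a valued field if $F$ is a subfield of $L$ and $|\cdot|_L$ restricts to $|\cdot|_F$. $\mathrm{Gal}(L/F)$ is the group of automorphisms of $L$ fixing $F$ pointwise; $L^{g}:=\{x\in L:g(x)=x\}$. For a self-map $h$ of finite order, $\mathrm{ord}(h)$ is the least $n\ge1$ such that the $n$-fold composite of $h$ is the identity. The group $\langle\mathrm{id}\rangle$ is the trivial subgroup of $\mathrm{Gal}(L/L^{g})$, and intermediate elements of a lattice are elements other than its top and bottom; the lattice of groups is that of the subgroups of $\mathrm{Gal}(L/L^{g})$. Basic function algebra: let $F,L$ be complete valued fields with $L$ a finite extension of $F$ as a valued field, $X$ a nonempty compact Hausdorff space, totally disconnected if $F$ is non-Archimedean, $g\in\mathrm{Gal}(L/F)$, and $\tau:X\to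 X$ a map of finite order with $\mathrm{ord}(\tau)\mid\mathrm{ord}(g)$, where $g$ and $\tau$ are continuous. With $C_L(X)$ the unital Banach $L$-algebra of all continuous $L$-valued functions on $X$ (pointwise operations, sup norm), the basic ${}^{L}/_{L^{g}}$ function algebra on $(X,\tau,g)$ is $C(X,\tau,g):=\{f\in C_L(X): f(\tau(x))=g(f(x))\text{ for all }x\in X\}$. An algebra of this form, for some such data, is called a basic function algebra. *)

(* Defs.v *)
From HB Require Import structures.
From mathcomp Require Import all_boot all_order all_algebra.
From mathcomp Require Import all_classical all_reals all_analysis.

Set Implicit Arguments.
Unset Strict Implicit.
Unset Printing Implicit Defensive.

Import Order.TTheory GRing.Theory Num.Theory.
Local Open Scope classical_set_scope.
Local Open Scope ring_scope.

(* The library's norms satisfy `|x *+ n| = `|x| *+ n, which excludes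
   non-Archimedean absolute values, so valuations are defined here. *)
Record valuation (R : realType) (K : fieldType) := Valuation {
  absv :> K -> R;
  absv_ge0 : forall x, 0 <= absv x;
  absv_eq0 : forall x, absv x = 0 <-> x = 0;
  absvM : forall x y, absv (x * y) = absv x * absv y;
  absvD : forall x y, absv (x + y) <= absv x + absv y }.

(* K seen as a metric space with distance v (x - y). *)
Definition valued (R : realType) (K : fieldType) (v : valuation R K) : Type :=
  K.

Section ValuedMetric.
Context (R : realType) (K : fieldType) (v : valuation R K).

HB.instance Definition _ := Choice.copy (valued v) K.

Let dist (x y : valued v) : R := v ((x : K) - (y : K)).

Let absv0 : v 0 = 0.
Proof. exact/absv_eq0. Qed.

Let absvN x : v (- x) = v x.
Proof.
have v1 : v 1 = 1.
  have := absvM v 1 1; rewrite mulr1 => /esym/eqP.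
  rewrite -subr_eq0 -{3}[v 1]mulr1 -mulrBr mulf_eq0 => /orP[/eqP/absv_eq0/eqP|].
    by rewrite oner_eq0.
  by rewrite subr_eq0 => /eqP.
have vN1 : v (-1) = 1.
  apply/eqP; rewrite -(@eqrXn2 _ 2) ?absv_ge0// expr1n expr2 -absvM.
  by rewrite mulrNN mulr1 v1.
by rewrite -mulN1r absvM vN1 mul1r.
Qed.

Let distxx x : dist x x = 0.
Proof. by rewrite /dist subrr. Qed.

Let dist_pos x y : dist x y = 0 -> x = y.
Proof. by move=> /absv_eq0/eqP; rewrite subr_eq0 => /eqP. Qed.

Let dist_sym x y : dist x y = dist y x.
Proof. by rewrite /dist -absvN opprB. Qed.

Let dist_triangle y x z : dist x z <= dist x y + dist y z.
Proof. by rewrite /dist (le_trans _ (absvD _ _ _))// addrA subrK. Qed.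

HB.instance Definition _ :=
  isMetric.Build R (valued v) distxx dist_pos dist_sym dist_triangle.

End ValuedMetric.

Definition is_complete (R : realType) (K : fieldType) (v : valuation R K) :=
  forall G : set_system (valued v), ProperFilter G -> cauchy G ->
    exists x : valued v, G --> x.

Definition nonarchimedean (R : realType) (K : fieldType) (v : valuation R K) :=
  forall a b : K, v (a - b) <= Num.max (v a) (v b).

(* A subfield F of L is given by a ring morphism iota : F -> L, which is
   automatically injective. *)
Definition finite_extension (F L : fieldType) (iota : {rmorphism F -> L}) :=
  exists (n : nat) (b : 'I_n -> L),
    forall x : L, exists c : 'I_n -> F, x = \sum_i iota (c i) * b i.

Definition valued_extension (R : realType) (F L : fieldType)
    (vF : valuation R F) (vL : valuation R L) (iota : {rmorphism F -> L}) :=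
  forall a : F, vL (iota a) = vF a.

Definition Gal (L : fieldType) (K : set L) : set (L -> L) :=
  [set h | [/\ bijective h, GRing.zmod_morphism h, GRing.monoid_morphism h &
               forall x, K x -> h x = x]].

Definition fixed_field (L : fieldType) (g : L -> L) : set L :=
  [set x | g x = x].

Definition subgroups (L : fieldType) (G : set (L -> L)) : set (set (L -> L)) :=
  [set H | [/\ H `<=` G, H id,
    forall h k, H h -> H k -> H (h \o k) &
    forall h k, H h -> cancel h k -> cancel k h -> H k]].

Definition is_ord (T : Type) (h : T -> T) (n : nat) :=
  [/\ (0 < n)%N, iter n h =1 id &
      forall k, (0 < k < n)%N -> ~ (iter k h =1 id)].

Definition CL (R : realType) (L : fieldType) (vL : valuation R L)
    (X : topologicalType) : set (X -> L) :=
  [set f | continuous (f : X -> valued vL)].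

(* These subsets determine the algebras: operations and norm are inherited
   from C_L(X). *)
Definition Cfix (R : realType) (L : fieldType) (vL : valuation R L)
    (X : topologicalType) (tau : X -> X) (g : L -> L) : set (X -> L) :=
  [set f | CL vL f /\ forall x, f (tau x) = g (f x)].

Definition basic_data (R : realType) (F L : fieldType)
    (vF : valuation R F) (vL : valuation R L) (iota : {rmorphism F -> L})
    (X : topologicalType) (tau : X -> X) (g : L -> L) : Prop :=
  [/\ [/\ is_complete vF, is_complete vL, valued_extension vF vL iota &
          finite_extension iota],
      [/\ [set: X] !=set0, compact [set: X], hausdorff_space X &
          nonarchimedean vF -> totally_disconnected [set: X]],
      Gal (range iota) g,
      continuous tau /\ continuous (g : valued vL -> valued vL) &
      exists m n : nat, [/\ is_ord tau m, is_ord g n & (m %| n)%N]].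

(* L, with its valuation, and X are determined by the ambient C_L(X); the
   base field, tau and g are not. *)
Definition basic_function_algebra (R : realType) (L : fieldType)
    (vL : valuation R L) (X : topologicalType) : set (set (X -> L)) :=
  [set A | exists (F : fieldType) (vF : valuation R F)
             (iota : {rmorphism F -> L}) (tau : X -> X) (g : L -> L),
             basic_data vF vL iota tau g /\ A = Cfix vL tau g].

(* Joins and meets are taken within Lam, not in the powerset of T. *)
Definition lattice_of_sets (T : Type) (Lam : set (set T)) :=
  forall A B, Lam A -> Lam B ->
    (exists J, [/\ Lam J, A `<=` J, B `<=` J &
       forall D, Lam D -> A `<=` D -> B `<=` D -> J `<=` D]) /\
    (exists M, [/\ Lam M, M `<=` A, M `<=` B &
       forall D, Lam D -> D `<=` A -> D `<=` B -> D `<=` M]).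

Definition lattice_with_intermediates (T : Type) (Lam : set (set T))
    (top bot : set T) :=
  [/\ lattice_of_sets Lam,
      Lam top /\ (forall A, Lam A -> A `<=` top),
      Lam bot /\ (forall A, Lam A -> bot `<=` A) &
      exists A, [/\ Lam A, A <> top & A <> bot]].

(* Main.v *)
Require Import Defs.
From HB Require Import structures.
From mathcomp Require Import all_boot all_order all_algebra.
From mathcomp Require Import all_classical all_reals all_analysis.

Local Open Scope classical_set_scope.

(** The group Gal(L/L^g) is cyclic, generated by g (Artin), so each of its
    subgroups H is generated by g^d, where d is the least positive exponent
    with g^d in H.  Attach to H the algebra of those continuous f such that
    f o tau^k = g^k o f whenever g^k lies in H.  The condition for k = d
    implies all the others, so this is the basic function algebra on
    (X, tau^d, g^d); the trivial group gives C_L(X), because g^k = id forces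
    tau^k = id, and the whole group gives C(X, tau, g).

    The assignment visibly reverses inclusions.  It also reflects them, and
    constant functions are enough to see it: the constants in the algebra of K
    are the elements of L fixed by K.  Hence, if the algebra of K is contained
    in that of H, every element of H fixes L^(g^d), where g^d generates K, and
    by Artin's theorem applied to g^d it is a power of g^d.  So the algebras
    form a lattice anti-isomorphic to the lattice of subgroups, and everything
    that is claimed about it is transported from there.

    Artin's theorem follows from the linear independence of distinct
    multiplicative maps: for sigma in Gal(L/L^g) and n = ord(g), the trace
    c + g c + ... + g^(n-1) c lies in L^g, so applying sigma to it yields a
    linear relation between the maps g^i and sigma o g^i, which are pairwise
    distinct unless sigma is a power of g. *)

Import GRing.Theory.
Local Open Scope ring_scope.

(** * Orders of self-maps *)

Section Iteration.
Context {T : Type}.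
Implicit Types h : T -> T.

Lemma iter_muln h d k x : iter k (iter d h) x = iter (k * d) h x.
Proof. by elim: k => //= k IH; rewrite IH -iterD. Qed.

Lemma iter_muln_id {h n} k : iter n h =1 id -> iter (k * n) h =1 id.
Proof. by move=> hn x; elim: k => //= k IH; rewrite mulSn iterD IH hn. Qed.

Lemma iter_commute {S : Type} (f : T -> S) h (g : S -> S) :
  (forall x, f (h x) = g (f x)) ->
  forall k x, f (iter k h x) = iter k g (f x).
Proof. by move=> fh k x; elim: k => //= k IH; rewrite fh IH. Qed.

Lemma is_ord_ex h N : (0 < N)%N -> iter N h =1 id -> exists n, is_ord h n.
Proof.
move=> N0 hN.
have ex : exists n, (0 < n)%N && `[< iter n h =1 id >].
  by exists N; rewrite N0; apply/asboolP.
case: (ex_minnP ex) => n /andP[n0 /asboolP hn] nmin.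
exists n; split=> // k /andP[k0 kn] hk.
suff : (n <= k)%N by rewrite leqNgt kn.
by apply: nmin; rewrite k0; apply/asboolP.
Qed.

Lemma is_ord_dvdn {h n k} : is_ord h n -> iter k h =1 id -> (n %| k)%N.
Proof.
move=> [n0 hn nmin] hk; rewrite /dvdn; apply/negPn/negP; rewrite -lt0n => r0.
apply: (nmin (k %% n)%N); first by rewrite r0 ltn_mod.
by move=> x; rewrite -[RHS]hk {2}(divn_eq k n) addnC iterD iter_muln_id.
Qed.

Lemma is_ord_inj {h n} : is_ord h n -> injective h.
Proof.
move=> [n0 hn _] x y hxy.
by rewrite -(hn x) -(hn y) -(prednK n0) !iterSr hxy.
Qed.

Lemma is_ord_iter_neq {h n i j} :
  is_ord h n -> (i < j < n)%N -> ~ iter i h =1 iter j h.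
Proof.
move=> hn /andP[ij jn] e; have [_ _ nmin] := hn.
apply: (nmin (j - i)%N).
  by rewrite subn_gt0 ij (leq_ltn_trans (leq_subr i j) jn).
move=> x; have inj_iter : injective (iter i h).
  by elim: i {ij e} => // i IH u v /= /(is_ord_inj hn) /IH.
by apply: inj_iter; rewrite -iterD subnKC ?e// ltnW.
Qed.

End Iteration.

(** * Linear independence of characters and Artin's theorem *)

Section Artin.
Context {L : fieldType}.
Implicit Types g h s : L -> L.

(** Dedekind's argument: replacing c by y c in a relation and subtracting
    chi n y times the relation eliminates the last map. *)
Lemma characters_independent (n : nat) (chi : nat -> L -> L) (a : nat -> L) :
  (forall i, (i < n)%N -> GRing.monoid_morphism (chi i)) ->
  (forall i j, (i < j < n)%N -> ~ chi i =1 chi j) ->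
  (forall c, \sum_(i < n) a i * chi i c = 0) ->
  forall i, (i < n)%N -> a i = 0.
Proof.
elim: n a => // n IH a chiM chi_neq rel.
have a0 i : (i < n)%N -> a i = 0.
  move=> i_lt; apply/eqP/negPn/negP => ai0.
  apply: (chi_neq i n) => [|y]; first by rewrite i_lt ltnSn.
  suff : a i * (chi i y - chi n y) = 0.
    by move/eqP; rewrite mulf_eq0 (negbTE ai0) subr_eq0 => /eqP.
  apply: (IH (fun k => a k * (chi k y - chi n y))) i_lt
    => [k k_lt|k l /andP[kl ln]|c].
  - exact/chiM/ltnW.
  - by apply: chi_neq; rewrite kl ltnW.
  transitivity (\sum_(k < n.+1) a k * chi k (y * c)
                - chi n y * \sum_(k < n.+1) a k * chi k c).
    rewrite mulr_sumr -sumrB big_ord_recr /= (chiM n _).2//.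
    rewrite mulrCA subrr addr0; apply: eq_bigr => k _.
    rewrite (chiM k _).2 ?(ltn_trans (ltn_ord k))//.
    by rewrite mulrBr mulrBl [chi n y * _]mulrCA !mulrA.
  by rewrite !rel mulr0 subr0.
move=> i; rewrite ltnS leq_eqVlt => /orP[/eqP ->|]; last exact: a0.
have := rel 1; rewrite big_ord_recr big1 /= ?add0r => [|k _].
  by rewrite (chiM n _).1// mulr1.
by rewrite a0 ?mul0r.
Qed.

Lemma zmod_morphism_sum h n (F : 'I_n -> L) :
  GRing.zmod_morphism h -> h (\sum_(i < n) F i) = \sum_(i < n) h (F i).
Proof.
move=> hB; have h0 : h 0 = 0 by have := hB 0 0; rewrite !subrr.
apply: (big_morph h) => // x y.
by rewrite -{1}[y]opprK hB -[- y]sub0r hB h0 sub0r opprK.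
Qed.

Lemma monoid_morphism_iter {g} k :
  GRing.monoid_morphism g -> GRing.monoid_morphism (iter k g).
Proof.
move=> [g1 gM]; split=> [|x y]; first by elim: k => //= k ->.
by elim: k => //= k ->; rewrite gM.
Qed.

Lemma zmod_morphism_iter {g} k :
  GRing.zmod_morphism g -> GRing.zmod_morphism (iter k g).
Proof. by move=> gB x y; elim: k => //= k ->; rewrite gB. Qed.

Lemma Gal_iter {K : set L} {g} k : Gal K g -> Gal K (iter k g).
Proof.
move=> [gbij gB gM gK]; split.
- elim: k => [|k IH]; first by exists id.
  exact: (bij_comp gbij IH).
- exact: zmod_morphism_iter.
- exact: monoid_morphism_iter.
- by move=> x Kx; elim: k => //= k ->; exact: gK.
Qed.

Lemma Gal_self {K : set L} {g} : Gal K g -> Gal (fixed_field g) g.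
Proof. by case=> gbij gB gM _; split. Qed.

(** Artin's theorem: otherwise the maps g^i and s o g^i, for i < ord(g), would
    be 2 ord(g) distinct characters, linearly related because s fixes the
    trace of every c. *)
Lemma Gal_fixed_field_iter {g s n} :
  is_ord g n -> GRing.zmod_morphism g -> GRing.monoid_morphism g ->
  Gal (fixed_field g) s -> exists k, s = iter k g.
Proof.
move=> gn gB gM [sbij sB sM sfix]; have [n0 gn1 _] := gn.
have [//|sN] := pselect (exists k, s = iter k g); exfalso.
have trace_fixed c : g (\sum_(i < n) iter i g c) = \sum_(i < n) iter i g c.
  case: n n0 gn1 {gn} => // n _ gn1.
  rewrite zmod_morphism_sum// big_ord_recr big_ord_recl /= addrC.
  by congr (_ + _); rewrite -[g _]/(iter n.+1 g c) gn1.
pose chi i := if (i < n)%N then iter i g else s \o iter (i - n) g.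
pose a i : L := if (i < n)%N then 1 else -1.
suff /eqP : a 0%N = 0 by rewrite /a n0 oner_eq0.
apply: (@characters_independent (n + n) chi a) => [i _|i j /andP[ij jn]|c|].
- rewrite /chi; case: ifP => _; first exact: monoid_morphism_iter.
  have [it1 itM] := monoid_morphism_iter (i - n) gM.
  by split=> [|x y] /=; rewrite ?it1 ?itM ?sM.1 ?sM.2.
- rewrite /chi; case: (ltnP j n) => [jn'|nj].
    by rewrite (ltn_trans ij jn'); apply: (is_ord_iter_neq gn); rewrite ij.
  case: (ltnP i n) => [i_lt|ni] e.
    (* g^i = s o g^(j-n) would give s = g^(i + n - (j-n)). *)
    apply: sN; exists (i + (n - (j - n)))%N; apply/funext => x.
    rewrite iterD e /= -iterD subnKC ?gn1//.
    by rewrite leq_subLR ltnW.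
  apply: (@is_ord_iter_neq _ g n (i - n) (j - n) gn).
    by rewrite ltn_sub2r ?(leq_ltn_trans ni ij)//= ltn_subLR.
  by move=> x; apply: (bij_inj sbij); exact: e.
- rewrite big_split_ord /=.
  rewrite (eq_bigr (fun i : 'I_n => iter i g c)); last first.
    by move=> i _; rewrite /a /chi ltn_ord mul1r.
  rewrite [X in _ + X](eq_bigr (fun i : 'I_n => - s (iter i g c))); last first.
    by move=> i _; rewrite /a /chi ltnNge leq_addr /= mulN1r addKn.
  by rewrite sumrN -zmod_morphism_sum// sfix ?subrr//; exact: trace_fixed.
- by rewrite ltn_addl.
Qed.

End Artin.

(** * Subgroups of a cyclic group of automorphisms *)

Section Subgroups.
Context {L : fieldType}.
Implicit Types (g h : L -> L) (G H : set (L -> L)).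

Lemma subgroup_iter {G H h} k : subgroups G H -> H h -> H (iter k h).
Proof.
by move=> [_ H1 HM _] Hh; elim: k => // k IH; exact: (HM h (iter k h)).
Qed.

Lemma subgroup_generator {G H g n} : is_ord g n -> subgroups G H ->
  exists d, [/\ (0 < d)%N, H (iter d g) &
                forall k, H (iter k g) -> (d %| k)%N].
Proof.
move=> [n0 gn _] sH; have [_ H1 HM _] := sH.
have gnid : iter n g = id by exact/funext.
have ex : exists d, (0 < d)%N && `[< H (iter d g) >].
  by exists n; rewrite n0; apply/asboolP; rewrite gnid.
case: (ex_minnP ex) => d /andP[d0 /asboolP Hd] dmin; exists d; split=> // k Hk.
rewrite /dvdn; apply/negPn/negP; rewrite -lt0n => r0.
have : (d <= k %% d)%N; last by rewrite leqNgt ltn_mod d0.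
apply: dmin; rewrite r0; apply/asboolP.
(* With q = k %/ d, the inverse of g^(q d) is the power q (n-1) of g^d. *)
suff -> : iter (k %% d) g = iter (k %/ d * n.-1) (iter d g) \o iter k g.
  by apply: HM => //; exact: (subgroup_iter _ sH).
apply/funext => x /=; rewrite iter_muln -iterD {3}(divn_eq k d) addnA.
have -> : (k %/ d * n.-1 * d + k %/ d * d)%N = (k %/ d * d * n)%N.
  by rewrite mulnAC addnC -mulnS prednK.
by rewrite iterD (iter_muln_id _ gn).
Qed.

End Subgroups.

(** * The algebras attached to subgroups *)

Section Extensions.
Context {R : realType} {F L : fieldType} {vF : valuation R F}
  {vL : valuation R L} {iota : {rmorphism F -> L}}
  {X : topologicalType} {tau : X -> X} {g : L -> L}.

(** Quantifying over all exponents, rather than choosing a generator of H,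
    makes the dependence on H visibly antitone. *)
Definition subgroup_algebra (vL : valuation R L) (tau : X -> X) (g : L -> L)
    (H : set (L -> L)) : set (X -> L) :=
  [set f | CL vL f /\
     forall k, H (iter k g) -> forall x, f (iter k tau x) = iter k g (f x)].

Local Notation algebra := (subgroup_algebra vL tau g).

Lemma subgroup_algebraS H K : H `<=` K -> algebra K `<=` algebra H.
Proof. by move=> HK f [cf fK]; split=> // k /HK; exact: fK. Qed.

Lemma subgroup_algebra_gen {H d} :
  H (iter d g) -> (forall k, H (iter k g) -> (d %| k)%N) ->
  algebra H = Cfix vL (iter d tau) (iter d g).
Proof.
move=> Hd dH; apply/seteqP; split=> f [cf fH]; split=> //; first exact: fH.
move=> k /dH /dvdnP[q ->] x.
by rewrite -!iter_muln; exact: iter_commute.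
Qed.

Hypothesis hdata : basic_data vF vL iota tau g.

(** The only delicate point is the divisibility of the orders: if
    (g^d)^r = id, then ord(g) divides r d, so ord(tau) does too, and
    (tau^d)^r = id. *)
Lemma basic_data_iter d : basic_data vF vL iota (iter d tau) (iter d g).
Proof.
have [hF hX hg [ctau cg] [m [n [tm gn mn]]]] := hdata.
split=> //; first exact: Gal_iter.
  split.
    elim: d => [|d IH] x /=; first exact: cvg_id.
    exact: (continuous_comp (IH x) (ctau _)).
  elim: d => [|d IH] x /=; first exact: cvg_id.
  exact: (@continuous_comp _ _ _ _ (g : valued vL -> valued vL) x (IH x) (cg _)).
have [[m0 tm1 _] [n0 gn1 _]] := (tm, gn).
have ord_iter (T : Type) (h : T -> T) r : (0 < r)%N -> iter r h =1 id ->
    exists r', is_ord (iter d h) r'.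
  move=> r0 hr; apply: (@is_ord_ex _ _ r) => // x.
  by rewrite iter_muln mulnC; exact: iter_muln_id.
have [m' tm'] := ord_iter _ _ _ m0 tm1; have [n' gn'] := ord_iter _ _ _ n0 gn1.
exists m', n'; split=> //; apply: (is_ord_dvdn tm') => x; rewrite iter_muln.
have [_ gn'1 _] := gn'.
have /(dvdn_trans mn)/dvdnP[q ->] : (n %| n' * d)%N.
  by apply: (is_ord_dvdn gn) => y; rewrite -iter_muln; exact: gn'1.
exact: iter_muln_id.
Qed.

Local Notation G := (Gal (fixed_field g)).

Lemma subgroup_algebra_basic H :
  subgroups G H -> basic_function_algebra vL (algebra H).
Proof.
move=> sH; have [_ _ _ _ [m [n [_ gn _]]]] := hdata.
have [d [_ Hd dH]] := subgroup_generator gn sH.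
exists F, vF, iota, (iter d tau), (iter d g).
by split; [exact: basic_data_iter|exact: subgroup_algebra_gen].
Qed.

Lemma subgroup_algebra_top : algebra [set id] = CL vL (X := X).
Proof.
have [_ _ _ _ [m [n [[_ tm1 _] gn mn]]]] := hdata.
apply/seteqP; split=> [f []//|f cf]; split=> // k /= gk x; rewrite gk.
have /(dvdn_trans mn)/dvdnP[q ->] : (n %| k)%N.
  by apply: (is_ord_dvdn gn) => y; rewrite gk.
by rewrite iter_muln_id.
Qed.

Lemma subgroup_algebra_bot : algebra G = Cfix vL tau g.
Proof.
have [_ _ hg _ _] := hdata; rewrite (@subgroup_algebra_gen _ 1)//.
exact: (Gal_self hg).
Qed.

(** The constants of the algebra of K = <g^d> are the elements of L^(g^d); if
    they lie in the algebra of H, then H is contained in Gal(L/L^(g^d)), which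
    is K by Artin's theorem. *)
Lemma subgroup_algebra_anti H K : subgroups G H -> subgroups G K ->
  (H `<=` K <-> algebra K `<=` algebra H).
Proof.
move=> sH sK; split=> [|KH h Hh]; first exact: subgroup_algebraS.
have [_ [[x _] _ _ _] [_ gB gM _] _ [m [n [_ gn _]]]] := hdata.
have [HG _ _ _] := sH; have [hbij hB hM hfix] := HG _ Hh.
have [e he] : exists e, h = iter e g.
  exact: Gal_fixed_field_iter gn _ _ (HG _ Hh).
have [d [_ Kd dK]] := subgroup_generator gn sK.
have [_ _ _ _ [_ [N [_ gN _]]]] := basic_data_iter d.
suff [k ->] : exists k, h = iter k (iter d g) by exact: (subgroup_iter _ sK).
apply: (Gal_fixed_field_iter gN).
- exact: zmod_morphism_iter.
- exact: monoid_morphism_iter.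
split=> // c fixc.
have [_ /(_ e)] : algebra H (fun=> c).
  apply: KH; rewrite (subgroup_algebra_gen Kd dK); split=> // y.
  exact: (@cst_continuous _ (valued vL)).
by rewrite -he => /(_ Hh x) <-.
Qed.

End Extensions.

(** * Transport of lattices *)

(** Reflecting inclusions makes phi injective, so joins and meets are swapped
    and an intermediate element cannot collapse onto an end. *)
Lemma lattice_with_intermediates_anti {S T : Type} (Lam : set (set S))
    (top bot : set S) (phi : set S -> set T) :
  (forall H K, Lam H -> Lam K -> (H `<=` K <-> phi K `<=` phi H)) ->
  lattice_with_intermediates Lam top bot ->
  lattice_with_intermediates (phi @` Lam) (phi bot) (phi top).
Proof.
move=> anti [lat [Ltop topP] [Lbot botP] [I [LI Itop Ibot]]].
have inj H K : Lam H -> Lam K -> phi H = phi K -> H = K.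
  by move=> LH LK e; apply/seteqP; split; apply/anti => //; rewrite e.
split.
- move=> _ _ [H LH <-] [K LK <-].
  have [[J [LJ HJ KJ Jmin]] [M [LM MH MK Mmax]]] := lat H K LH LK; split.
  + exists (phi M); split; [by exists M|exact/anti|exact/anti|].
    by move=> _ [D LD <-] /anti HD /anti KD; apply/anti => //; apply: Mmax; auto.
  + exists (phi J); split; [by exists J|exact/anti|exact/anti|].
    by move=> _ [D LD <-] /anti HD /anti KD; apply/anti => //; apply: Jmin; auto.
- by split=> [|_ [H LH <-]]; [exists bot|apply/anti => //; exact: botP].
- by split=> [|_ [H LH <-]]; [exists top|apply/anti => //; exact: topP].
- exists (phi I); split; [by exists I| |].
  + by move/inj => e; apply: Ibot; exact: e.
  + by move/inj => e; apply: Itop; exact: e.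
Qed.

Theorem theorem5p4p1 (R : realType) (F L : fieldType)
    (vF : valuation R F) (vL : valuation R L) (iota : {rmorphism F -> L})
    (X : topologicalType) (tau : X -> X) (g : L -> L)
    (hdata : basic_data vF vL iota tau g)
    (hgroups : lattice_with_intermediates
                 (subgroups (Gal (fixed_field g)))
                 (Gal (fixed_field g)) [set id]) :
  exists Lam : set (set (X -> L)),
    [/\ Lam `<=` @basic_function_algebra R L vL X,
        lattice_with_intermediates Lam (CL vL (X := X)) (Cfix vL tau g) &
        exists Phi : set (L -> L) -> set (X -> L),
          set_bij (subgroups (Gal (fixed_field g))) Lam Phi /\
          (forall H K : set (L -> L),
             subgroups (Gal (fixed_field g)) H ->
             subgroups (Gal (fixed_field g)) K ->
             (H `<=` K <-> Phi K `<=` Phi H))].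
Proof.
have anti := subgroup_algebra_anti hdata.
exists (subgroup_algebra vL tau g @` subgroups (Gal (fixed_field g))); split.
- by move=> _ [H sH <-]; exact: (subgroup_algebra_basic hdata).
- rewrite -(subgroup_algebra_top hdata) -(subgroup_algebra_bot hdata).
  exact: lattice_with_intermediates_anti.
- exists (subgroup_algebra vL tau g); split=> //; split=> //.
  move=> H K /set_mem sH /set_mem sK e; apply/seteqP.
  by split; [apply/(anti _ _ sH sK)|apply/(anti _ _ sK sH)]; rewrite e.
Qed.
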